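(* Let $f\in\mathcal G(\mathbb R)$. Let $\alpha\in\mathbb R\setminus\mathbb Q$, $\alpha>0$, be an algebraic number. If $f$ is periodic with periods $1$ and $\alpha$, i.e., if $f(x+1)=f(x)$ and $f(x+\alpha)=f(x)$ hold as equalities in $\mathcal G(\mathbb R)$, then $f$ is a generalized constant.
   Context: The special Colombeau algebra on $\mathbb R$: let $\mathcal E(\mathbb R)$ be the algebra of all nets $(u_\varepsilon)_{\varepsilon\in(0,1)}$ of $\mathcal C^\infty$-functions $\mathbb R\to\mathbb C$. Let $\mathcal E_M(\mathbb R)$ be the set of $(u_\varepsilon)_\varepsilon\in\mathcal E(\mathbb R)$ such that for every compact $K\subset\mathbb R$ and every $k\in\mathbb N$ there exists $b\in\mathbb R$ with $\sup_{x\in K}|u_\varepsilon^{(k)}(x)|=O(\varepsilon^b)$ as $\varepsilon\to0$. Let $\mathcal N(\mathbb R)$ be the set of those $(u_\varepsilon)_\varepsilon\in\mathcal E(\mathbb R)$ such that for every compact $K$, every $k\in\mathbb N$ and every $b\in\mathbb R$, $\sup_{x\in K}|u_\varepsilon^{(k)}(x)|=O(\varepsilon^b)$ as $\varepsilon\to0$. Then $\mathcal G(\mathbb R)=\mathcal E_M(\mathbb R)/\mathcal N(\mathbb R)$. For $h\in\mathbb R$, $f(x+h)$ denotes the class of $(x\mapsto f_\varepsilon(x+h))_\varepsilon$, where $(f_\varepsilon)_\varepsilon$ is a representative of $f$. $f$ is a generalized constant if, for a representative $(f_\varepsilon)_\varepsilon$ of $f$, the net $(f_\varepsilon-f_\varepsilon(0))_\varepsilon$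 belongs to $\mathcal N(\mathbb R)$. *)

(* Defs.v *)
From HB Require Import structures.
From mathcomp Require Import all_boot all_order all_algebra.
From mathcomp Require Import generic_quotient ring_quotient.
From mathcomp Require Import all_classical all_reals all_analysis.
From mathcomp Require Import complex.

Set Implicit Arguments.
Unset Strict Implicit.
Unset Printing Implicit Defensive.

Import Order.TTheory GRing.Theory Num.Theory.
Import numFieldNormedType.Exports.

Local Open Scope classical_set_scope.
Local Open Scope ring_scope.
Local Open Scope quotient_scope.

(** [Rcomplex R] is the field of complex numbers over [R : realType] seen as a
    real vector space, with the real-valued modulus as norm; functions
    [R -> Rcomplex R] are differentiated as functions into a real normed
    space. *)
Section Rcomplex_normedModType.
Variable R : realType.
Local Notation C := (Rcomplex R).

Lemma normrZ_Rcomplex (l : R) (z : C) : `|l *: z| = `|l| * `|z|.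
Proof.
case: z => a b; rewrite /Num.norm/= /GRing.scale/=.
by rewrite !exprMn -mulrDr sqrtrM ?sqr_ge0// sqrtr_sqr.
Qed.

HB.instance Definition _ := PseudoMetric.copy C (pseudoMetric_normed C).
HB.instance Definition _ := isPointed.Build C 0.
HB.instance Definition _ := NormedZmod_PseudoMetric_eq.Build R C erefl.
HB.instance Definition _ :=
  PseudoMetricNormedZmod_Lmodule_isNormedModule.Build R C normrZ_Rcomplex.

Lemma normM_Rcomplex (x y : C) : `|x * y : C| = `|x| * `|y| :> R.
Proof. exact: Normc.normcM. Qed.

Lemma cvgM_Rcomplex (T : Type) (F : set_system T) (FF : Filter F)
    (f g : T -> C) (a b : C) :
  f x @[x --> F] --> a -> g x @[x --> F] --> b ->
  ((f x * g x : C)) @[x --> F] --> (a * b : C).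
Proof.
move=> fa gb.
have fa0 : `|f x - a| @[x --> F] --> (0 : R).
  by rewrite -(@normr0 _ C) -(subrr a); apply: cvg_norm; apply: cvgB => //; exact: cvg_cst.
have gb0 : `|g x - b| @[x --> F] --> (0 : R).
  by rewrite -(@normr0 _ C) -(subrr b); apply: cvg_norm; apply: cvgB => //; exact: cvg_cst.
have H : (`|f x - a| * `|g x| + `|a| * `|g x - b|) @[x --> F] --> (0 : R).
  have -> : (0 : R) = 0 * `|b| + `|a| * 0 by rewrite mul0r mulr0 addr0.
  by apply: cvgD; apply: cvgM => //; [exact: cvg_norm|exact: cvg_cst].
apply/cvgrPdistC_lt => e e0.
have /cvgr0_norm_lt /(_ e e0) := H.
apply: filterS => x /=; apply: le_lt_trans.
rewrite ger0_norm ?addr_ge0 ?mulr_ge0//.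
have -> : (f x * g x : C) - a * b = (f x - a) * g x + a * (g x - b).
  by rewrite mulrBl mulrBr addrA subrK.
by rewrite (le_trans (ler_normD _ _))// !normM_Rcomplex.
Qed.

Lemma is_deriveM_Rcomplex (f g : R -> C) (x : R) (a b : C) :
  is_derive x 1 f a -> is_derive x 1 g b ->
  is_derive x 1 (fun y => f y * g y : C) (a * g x + f x * b).
Proof.
move=> [df fa] [dg gb].
have H : h^-1 *: (((fun y => f y * g y : C) \o shift x) (h *: 1) - f x * g x)
    @[h --> 0^'] --> (a * g x + f x * b : C).
  have cx : shift x (h *: 1) @[h --> (0 : R)^'] --> x.
    apply: cvg_within_filter.
    have H : h + x @[h --> (0 : R)] --> 0 + x.
      by apply: cvgD; [exact: cvg_id|exact: cvg_cst].
    rewrite add0r in H; apply: cvg_trans H; apply: near_eq_cvg; near=> h.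
    by rewrite /= /GRing.scale/= mulr1.
  have cg : (g \o shift x) (h *: 1) @[h --> (0 : R)^'] --> g x.
    have /differentiable_continuous gx : differentiable g x.
      exact/derivable1_diffP.
    exact: cvg_comp cx gx.
  have Df := df; rewrite /derivable in Df.
  have Dg := dg; rewrite /derivable in Dg.
  have L : (h^-1 *: ((f \o shift x) (h *: 1) - f x) * (g \o shift x) (h *: 1)
       + f x * (h^-1 *: ((g \o shift x) (h *: 1) - g x)))
    @[h --> (0:R)^'] --> (a * g x + f x * b : C).
    apply: cvgD; apply: cvgM_Rcomplex => //.
    - by rewrite -fa.
    - exact: cvg_cst.
    - by rewrite -gb.
  apply: cvg_trans L; apply: near_eq_cvg; near=> h.
  rewrite /= [X in _ + X]mulrC -!scalerAl -scalerDr; congr (_ *: _).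
  rewrite [X in _ + X]mulrC.
  by rewrite mulrBl mulrBr addrA subrK.
split; first by apply/cvg_ex; eexists; exact: H.
exact/cvg_lim.
Unshelve. all: by end_near. Qed.

End Rcomplex_normedModType.

Section smooth.
Variable R : realType.
Local Notation C := (Rcomplex R).
Implicit Types f g : R -> C.

Definition smooth f := forall (k : nat) (x : R), derivable (derive1n k f) x 1.

Lemma derive1nSr k f : derive1n k.+1 f = derive1n k (derive1 f).
Proof. exact: iterSr. Qed.

Lemma smoothP f :
  smooth f <-> (forall x : R, derivable f x 1) /\ smooth (derive1 f).
Proof.
split=> [fs|[f1 fs] [|k]]; last by rewrite derive1nSr.
  by split=> [x|k x]; [exact: (fs 0%N)|rewrite -derive1nSr].
exact: f1.
Qed.

Lemma smooth_derivable f x : smooth f -> derivable f x 1.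
Proof. by move=> /(_ 0%N). Qed.

Lemma smooth_derive1 f : smooth f -> smooth (derive1 f).
Proof. by move=> /smoothP[]. Qed.

Lemma smooth_continuous k f : smooth f -> continuous (derive1n k f).
Proof.
move=> fs x; apply: differentiable_continuous.
exact/derivable1_diffP/fs.
Qed.

Lemma derive1D f g : smooth f -> smooth g ->
  derive1 (f + g) = derive1 f + derive1 g.
Proof.
move=> fs gs; apply/funext => x.
by rewrite [RHS]/GRing.add/= !derive1E deriveD//; exact: smooth_derivable.
Qed.

Lemma derive1B f g : smooth f -> smooth g ->
  derive1 (f - g) = derive1 f - derive1 g.
Proof.
move=> fs gs; apply/funext => x.
by rewrite [RHS]/GRing.add/= [in RHS]/GRing.opp/= !derive1E deriveB//;
  exact: smooth_derivable.
Qed.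

Lemma derive1nD k f g : smooth f -> smooth g ->
  derive1n k (f + g) = derive1n k f + derive1n k g.
Proof.
elim: k f g => // k ih f g fs gs.
by rewrite !derive1nSr derive1D// ih//; exact: smooth_derive1.
Qed.

Lemma derive1nB k f g : smooth f -> smooth g ->
  derive1n k (f - g) = derive1n k f - derive1n k g.
Proof.
elim: k f g => // k ih f g fs gs.
by rewrite !derive1nSr derive1B// ih//; exact: smooth_derive1.
Qed.

Lemma smoothD f g : smooth f -> smooth g -> smooth (f + g).
Proof. by move=> fs gs k x; rewrite derive1nD//; exact: derivableD. Qed.

Lemma smoothB f g : smooth f -> smooth g -> smooth (f - g).
Proof. by move=> fs gs k x; rewrite derive1nB//; exact: derivableB. Qed.

Lemma derive1M f g : smooth f -> smooth g ->
  derive1 (f * g) = derive1 f * g + f * derive1 g.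
Proof.
move=> fs gs; apply/funext => x.
have fx : is_derive x 1 f (derive1 f x).
  by rewrite derive1E; exact/derivableP/smooth_derivable.
have gx : is_derive x 1 g (derive1 g x).
  by rewrite derive1E; exact/derivableP/smooth_derivable.
by rewrite derive1E; have [_] := is_deriveM_Rcomplex fx gx.
Qed.

Let smooth_upto n f := forall (k : nat) (x : R), (k < n)%N -> derivable (derive1n k f) x 1.

Let smooth_uptoS n f :
  smooth_upto n.+1 f <-> (forall x : R, derivable f x 1) /\ smooth_upto n (derive1 f).
Proof.
split=> [fs|[f1 fs] [|k] x kn]; last by rewrite derive1nSr; exact: fs.
  by split=> [x|k x kn]; [exact: (fs 0%N)|rewrite -derive1nSr; exact: fs].
exact: f1.
Qed.

Let smooth_uptoD n f g :
  smooth_upto n f -> smooth_upto n g -> smooth_upto n (f + g).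
Proof.
elim: n f g => // n ih f g /smooth_uptoS[f1 fs] /smooth_uptoS[g1 gs].
apply/smooth_uptoS; split=> [x|]; first exact: derivableD.
rewrite (_ : derive1 _ = derive1 f + derive1 g); first exact: ih.
apply/funext => x.
by rewrite [RHS]/GRing.add/= !derive1E deriveD.
Qed.

Lemma smoothM f g : smooth f -> smooth g -> smooth (f * g).
Proof.
move=> fs gs k x.
suff H n : smooth_upto n (f * g) by exact: (H k.+1).
elim: n f g fs gs {k x} => // n ih f g fs gs.
apply/smooth_uptoS; split=> [x|].
  have fx := derivableP (fs 0%N x : derivable f x 1).
  have gx := derivableP (gs 0%N x : derivable g x 1).
  by have [] := is_deriveM_Rcomplex fx gx.
by rewrite derive1M//; apply: smooth_uptoD; apply: ih => //;
  exact: smooth_derive1.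
Qed.

Lemma derive1_cst0 (a : C) : derive1 (cst a : R -> C) = cst 0.
Proof. by apply/funext => x; rewrite derive1_cst. Qed.

Lemma derive1n_cst k (a : C) :
  derive1n k (cst a : R -> C) = cst (if k is 0 then a else 0).
Proof.
by elim: k a => // k ih a; rewrite derive1nSr derive1_cst0 ih; case: k {ih}.
Qed.

Lemma smooth_cst (a : C) : smooth (cst a).
Proof. by move=> k x; rewrite derive1n_cst; exact: derivable_cst. Qed.

Lemma derive1_shift (h : R) f :
  derive1 (fun x => f (x + h)) = fun x => derive1 f (x + h).
Proof.
by apply/funext => x; rewrite /derive1; under eq_fun do rewrite -addrA.
Qed.

Lemma derive1n_shift k (h : R) f :
  derive1n k (fun x => f (x + h)) = fun x => derive1n k f (x + h).
Proof. by elim: k f => // k ih f; rewrite !derive1nSr derive1_shift ih. Qed.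

Lemma smooth_shift (h : R) f : smooth f -> smooth (fun x => f (x + h)).
Proof.
move=> fs k x; rewrite derive1n_shift.
have := fs k (x + h); rewrite /derivable /=.
by under eq_fun do rewrite addrA.
Qed.

End smooth.

Section nets.
Variable R : realType.

(** The index set ]0, 1[ of the nets. *)
Definition eps_index := {e : R | 0 < e < 1}.

Lemma half_eps_index : 0 < 2^-1 :> R /\ (2^-1 : R) < 1.
Proof. by split; [rewrite invr_gt0|rewrite invf_lt1// ltr1n]. Qed.

HB.instance Definition _ := Choice.on eps_index.
HB.instance Definition _ := isPointed.Build eps_index
  (exist _ (2^-1 : R) (introT andP half_eps_index)).

(** The filter "e tends to 0" on ]0, 1[. *)
Definition eps_to0 : set_system eps_index :=
  filter_from [set d : R | 0 < d] (fun d => [set e | val e < d]).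

Global Instance eps_to0_proper : ProperFilter eps_to0.
Proof.
apply: filter_from_proper.
  apply: filter_from_filter; first by exists 1 => /=.
  move=> i j i0 j0; exists (Num.min i j); first by rewrite /= lt_min i0.
  by move=> e /=; rewrite lt_min => /andP[].
move=> d /= d0.
have m0 : 0 < Num.min (d / 2) 2^-1.
  by rewrite lt_min divr_gt0//; have [->] := half_eps_index.
have m1 : Num.min (d / 2) 2^-1 < 1.
  by rewrite gt_min; have [_ ->] := half_eps_index; rewrite orbT.
have mP : 0 < Num.min (d / 2) 2^-1 < 1 by rewrite m0 m1.
exists (exist (fun e : R => 0 < e < 1) _ mP) => //=.
by rewrite gt_min ltr_pdivrMr// mulrDr mulr1 ltrDl d0.
Qed.

Canonical eps_to0_filter_on := FilterType eps_to0 _.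

Local Notation net := (eps_index -> R -> Rcomplex R).
Implicit Types (u v : net) (K : set R).

(** The supremum is always finite when [K] is compact and [u] is smooth; it is
    [0] when [K] is empty. *)
Definition deriv_sup u K (k : nat) (e : eps_index) : R :=
  sup [set `|derive1n k (u e) x| | x in K].

Definition smooth_net u := forall e, smooth (u e).

Definition moderate u := smooth_net u /\
  forall K, compact K -> forall k : nat, exists b : R,
    deriv_sup u K k =O_eps_to0 (fun e => val e `^ b).

Definition negligible u := smooth_net u /\
  forall K, compact K -> forall (k : nat) (b : R),
    deriv_sup u K k =O_eps_to0 (fun e => val e `^ b).

(** By [deriv_supP], an equivalent form of the estimates that avoids [sup]. *)
Definition pointwiseO u K k b := exists2 c : R, 0 < c &
  \forall e \near eps_to0, forall x, K x ->
    `|derive1n k (u e) x| <= c * val e `^ b.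

Lemma deriv_supP u K k b : smooth_net u -> compact K ->
  deriv_sup u K k =O_eps_to0 (fun e => val e `^ b) <-> pointwiseO u K k b.
Proof.
move=> us Kc; rewrite eqOP.
have pw0 (e : eps_index) : 0 <= val e `^ b by exact: powR_ge0.
split.
  move=> /bigO_exP[c c0 H]; exists c => //.
  apply: filterS H => e; rewrite [X in _ <= _ * X]ger0_norm// => H x Kx.
  apply: le_trans H; apply: le_trans (ler_norm _).
  apply: ub_le_sup; last by exists x.
  have : compact [set `|derive1n k (u e) y| | y in K].
    apply: continuous_compact => //; apply: continuous_subspaceT => y.
    apply: (cvg_comp _ _ (@smooth_continuous R k _ (us e) y)).
    exact: norm_continuous.
  move=> /compact_bounded[M [_ HM]]; exists (M + 1) => y Hy.
  by apply: le_trans (ler_norm _) (HM _ _ _ Hy); rewrite ltrDl.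
move=> [c c0 H]; apply/bigO_exP; exists c => //.
apply: filterS H => e H; rewrite [X in _ <= _ * X]ger0_norm//.
have [->|/set0P[x Kx]] := eqVneq K set0.
  by rewrite /deriv_sup image_set0 sup0 normr0 mulr_ge0// ltW.
have ub : ubound [set `|derive1n k (u e) x| | x in K] (c * val e `^ b).
  by move=> _ [y Ky <-]; exact: H.
rewrite ger0_norm; last first.
  apply: (@le_trans _ _ `|derive1n k (u e) x|) => //.
  by apply: ub_le_sup; [exists (c * val e `^ b)|exists x].
by apply: ge_sup => //; exists `|derive1n k (u e) x|; exists x.
Qed.

Lemma pointwiseO_le u K k b b' : b' <= b ->
  pointwiseO u K k b -> pointwiseO u K k b'.
Proof.
move=> bb' [c c0 H]; exists c => //; apply: filterS H => e H x Kx.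
apply: le_trans (H x Kx) _; rewrite ler_pM2l//.
have /andP[e0 e1] := valP e.
by apply: ger_powR => //; rewrite e0 ltW.
Qed.

Lemma pointwiseOD u v K k b : smooth_net u -> smooth_net v ->
  pointwiseO u K k b -> pointwiseO v K k b -> pointwiseO (u + v) K k b.
Proof.
move=> us vs [c c0 Hc] [d d0 Hd]; exists (c + d); first exact: addr_gt0.
apply: filterS2 Hc Hd => e Hc Hd x Kx.
rewrite (derive1nD k (us e) (vs e)) mulrDl (le_trans (ler_normD _ _))//.
by rewrite lerD ?Hc ?Hd.
Qed.

Lemma pointwiseOB u v K k b : smooth_net u -> smooth_net v ->
  pointwiseO u K k b -> pointwiseO v K k b -> pointwiseO (u - v) K k b.
Proof.
move=> us vs [c c0 Hc] [d d0 Hd]; exists (c + d); first exact: addr_gt0.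
apply: filterS2 Hc Hd => e Hc Hd x Kx.
rewrite (derive1nB k (us e) (vs e)) mulrDl (le_trans (ler_normB _ _))//.
by rewrite lerD ?Hc ?Hd.
Qed.

Definition net_derive1 u : net := fun e => derive1 (u e).

Lemma pointwiseOS u K k b :
  pointwiseO u K k.+1 b <-> pointwiseO (net_derive1 u) K k b.
Proof.
split=> -[c c0 H]; exists c => //; apply: filterS H => e H x Kx.
  by rewrite -derive1nSr; exact: H.
by rewrite derive1nSr; exact: H.
Qed.

Lemma smooth_netM u v : smooth_net u -> smooth_net v -> smooth_net (u * v).
Proof. by move=> us vs e; exact: smoothM. Qed.

Lemma net_derive1M u v : smooth_net u -> smooth_net v ->
  net_derive1 (u * v) = net_derive1 u * v + u * net_derive1 v.
Proof. by move=> us vs; apply/funext => e; exact: derive1M. Qed.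

Lemma smooth_net_derive1 u : smooth_net u -> smooth_net (net_derive1 u).
Proof. by move=> us e; exact: smooth_derive1. Qed.

Lemma pointwiseOM0 u v K a b :
  pointwiseO u K 0 a -> pointwiseO v K 0 b -> pointwiseO (u * v) K 0 (a + b).
Proof.
move=> [c c0 Hc] [d d0 Hd]; exists (c * d); first exact: mulr_gt0.
apply: filterS2 Hc Hd => e Hc Hd x Kx.
have /andP[e0 e1] := valP e.
rewrite powRD; last by rewrite (gt_eqF e0) implybT.
rewrite [X in `|X|](_ : _ = u e x * v e x)// normM_Rcomplex mulrACA.
by rewrite ler_pM ?Hc ?Hd.
Qed.

Lemma pointwiseOM_moderate K k u v : smooth_net u -> smooth_net v ->
  (forall j, exists b, pointwiseO u K j b) ->
  (forall j, exists b, pointwiseO v K j b) ->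
  exists b, pointwiseO (u * v) K k b.
Proof.
elim: k u v => [|k ih] u v us vs Hu Hv.
  have [a Ha] := Hu 0%N; have [b Hb] := Hv 0%N.
  by exists (a + b); exact: pointwiseOM0.
have us' := smooth_net_derive1 us; have vs' := smooth_net_derive1 vs.
have Hu' j : exists b, pointwiseO (net_derive1 u) K j b.
  by have [b] := Hu j.+1; exists b; exact/pointwiseOS.
have Hv' j : exists b, pointwiseO (net_derive1 v) K j b.
  by have [b] := Hv j.+1; exists b; exact/pointwiseOS.
have [a Ha] := ih _ _ us' vs Hu' Hv.
have [b Hb] := ih _ _ us vs' Hu Hv'.
exists (Num.min a b); apply/pointwiseOS; rewrite net_derive1M//.
apply: pointwiseOD; try exact: smooth_netM.
  by apply: pointwiseO_le Ha; rewrite ge_min lexx.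
by apply: pointwiseO_le Hb; rewrite ge_min lexx orbT.
Qed.

Lemma pointwiseOM_negligible K k u v : smooth_net u -> smooth_net v ->
  (forall j, exists b, pointwiseO u K j b) ->
  (forall j b, pointwiseO v K j b) ->
  forall b, pointwiseO (u * v) K k b.
Proof.
elim: k u v => [|k ih] u v us vs Hu Hv b.
  have [a Ha] := Hu 0%N; have := pointwiseOM0 Ha (Hv 0%N (b - a)).
  by rewrite addrC subrK.
have us' := smooth_net_derive1 us; have vs' := smooth_net_derive1 vs.
have Hu' j : exists b, pointwiseO (net_derive1 u) K j b.
  by have [c] := Hu j.+1; exists c; exact/pointwiseOS.
have Hv' j c : pointwiseO (net_derive1 v) K j c by exact/pointwiseOS.
apply/pointwiseOS; rewrite net_derive1M//.
by apply: pointwiseOD; [exact: smooth_netM|exact: smooth_netM|exact: ih|exact: ih].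
Qed.

Lemma moderateP u : moderate u <-> smooth_net u /\
  forall K, compact K -> forall k, exists b, pointwiseO u K k b.
Proof.
by split=> -[us H]; split=> // K Kc k; have [b Hb] := H K Kc k; exists b;
  apply/deriv_supP.
Qed.

Lemma negligibleP u : negligible u <-> smooth_net u /\
  forall K, compact K -> forall k b, pointwiseO u K k b.
Proof. by split=> -[us H]; split=> // K Kc k b; apply/deriv_supP => //; exact: H. Qed.

Lemma moderate_cst (a : Rcomplex R) : moderate (fun=> cst a).
Proof.
apply/moderateP; split=> [e|K Kc k]; first exact: smooth_cst.
exists 0; exists (`|a| + 1); first by rewrite ltr_wpDl.
apply: filterE => e x _; rewrite powRr0 mulr1 derive1n_cst.
by case: k => [|k] /=; rewrite ?normr0 ?addr_ge0// lerDl.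
Qed.

Definition moderate_pred : {pred net} := fun u => `[< moderate u >].

Lemma moderate_subring : GRing.subring_closed moderate_pred.
Proof.
split=> [|u v|u v]; rewrite ?unfold_in /moderate_pred.
- exact/asboolP/moderate_cst.
- move=> /asboolP/moderateP[us Hu] /asboolP/moderateP[vs Hv].
  apply/asboolP/moderateP; split=> [e|K Kc k]; first exact: smoothB.
  have [a Ha] := Hu K Kc k; have [b Hb] := Hv K Kc k.
  exists (Num.min a b); apply: pointwiseOB => //.
    by apply: pointwiseO_le Ha; rewrite ge_min lexx.
  by apply: pointwiseO_le Hb; rewrite ge_min lexx orbT.
- move=> /asboolP/moderateP[us Hu] /asboolP/moderateP[vs Hv].
  apply/asboolP/moderateP; split=> [|K Kc k]; first exact: smooth_netM.
  by apply: pointwiseOM_moderate => // j; [exact: Hu|exact: Hv].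
Qed.

HB.instance Definition _ :=
  GRing.isSubringClosed.Build _ moderate_pred moderate_subring.

Record moderate_net := ModerateNet {
  moderate_net_val :> net;
  _ : moderate_net_val \in moderate_pred }.

HB.instance Definition _ := [isSub for moderate_net_val].
HB.instance Definition _ := [Choice of moderate_net by <:].
HB.instance Definition _ := [SubChoice_isSubComNzRing of moderate_net by <:].

Lemma moderate_netP (u : moderate_net) : moderate u.
Proof. by apply/asboolP; exact: (valP u). Qed.

Definition negligible_pred : {pred moderate_net} :=
  fun u : moderate_net => `[< negligible u >].

Lemma negligible_ideal : idealr_closed negligible_pred.
Proof.
split; rewrite ?unfold_in /negligible_pred.
- apply/asboolP/negligibleP; split=> [e|K Kc k b]; first exact: smooth_cst.
  exists 1 => //; apply: filterE => e x _.
  rewrite mul1r (derive1n_cst k (0 : Rcomplex R)).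
  by case: k => [|k] /=; rewrite normr0 powR_ge0.
- apply/asboolPn => /negligibleP[_ /(_ [set 0] (@compact_set1 _ _) 0%N 1)].
  move=> [c c0 H].
  have [e [/= + ec]] : exists e : eps_index,
      (forall x, [set 0] x ->
        `|derive1n 0 ((1 : moderate_net) e) x| <= c * val e `^ 1)
      /\ val e < c^-1.
    apply: (@filter_ex _ eps_to0); apply: filterI => //.
    by exists c^-1 => //=; rewrite invr_gt0.
  move=> /(_ 0 erefl); have /andP[e0 e1] := valP e.
  rewrite (powRr1 (ltW e0)).
  have n1 : `|1 : Rcomplex R| = 1 :> R.
    by rewrite /Num.norm/= expr1n expr0n addr0 sqrtr1.
  rewrite -[X in X <= _]/(`|1 : Rcomplex R|) n1.
  by rewrite leNgt mulrC -ltr_pdivlMr// div1r ec.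
- move=> a u v; rewrite !unfold_in /negligible_pred.
  move=> /asboolP/negligibleP[us Hu] /asboolP/negligibleP[vs Hv].
  have /moderateP[as' Ha] := moderate_netP a.
  have auvE : moderate_net_val (a * u + v) =
      moderate_net_val a * moderate_net_val u + moderate_net_val v by [].
  apply/asboolP/negligibleP; rewrite auvE.
  have aus := smooth_netM as' us.
  split=> [e|K Kc k b]; first exact: (smoothD (aus e) (vs e)).
  apply: pointwiseOD aus vs _ (Hv K Kc k b).
  by apply: pointwiseOM_negligible as' us (Ha K Kc) (Hu K Kc) _.
Qed.

HB.instance Definition _ := isIdealr.Build _ negligible_pred negligible_ideal.

Definition colombeau := {ideal_quot negligible_pred}.

HB.instance Definition _ := GRing.ComNzRing.on colombeau.

Lemma colombeauP (u v : moderate_net) :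
  (\pi_colombeau u = \pi_colombeau v) <-> negligible (fun e x => u e x - v e x).
Proof.
split=> [/eqP|H]; last apply/eqP; rewrite -Quotient.idealrBE.
  by move=> /asboolP.
exact/asboolP.
Qed.

Definition shift_net (h : R) u : net := fun e x => u e (x + h).

Lemma compact_shift (h : R) K : compact K -> compact [set x + h | x in K].
Proof.
move=> Kc; apply: continuous_compact => //; apply: continuous_subspaceT => x.
by apply: cvgD; [exact: cvg_id|exact: cvg_cst].
Qed.

Lemma smooth_net_shift (h : R) u : smooth_net u -> smooth_net (shift_net h u).
Proof. by move=> us e; exact: smooth_shift. Qed.

Lemma pointwiseO_shift (h : R) u K k b :
  pointwiseO u [set x + h | x in K] k b -> pointwiseO (shift_net h u) K k b.
Proof.
move=> [c c0 H]; exists c => //; apply: filterS H => e H x Kx.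
by rewrite derive1n_shift; apply: H; exists x.
Qed.

Lemma moderate_shift (h : R) u : moderate u -> moderate (shift_net h u).
Proof.
move=> /moderateP[us Hu]; apply/moderateP; split; first exact: smooth_net_shift.
move=> K Kc k; have [b Hb] := Hu _ (@compact_shift h _ Kc) k.
by exists b; exact: pointwiseO_shift.
Qed.

Lemma negligible_shift (h : R) u : negligible u -> negligible (shift_net h u).
Proof.
move=> /negligibleP[us Hu]; apply/negligibleP; split; first exact: smooth_net_shift.
by move=> K Kc k b; apply: pointwiseO_shift; exact: (Hu _ (@compact_shift h _ Kc)).
Qed.

Definition moderate_net_shift (h : R) (u : moderate_net) : moderate_net :=
  ModerateNet (asboolT (@moderate_shift h _ (moderate_netP u))).

(** Well defined on classes, by [translate_pi]. *)
Definition translate (h : R) (f : colombeau) : colombeau :=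
  \pi_colombeau (moderate_net_shift h (repr f)).

Lemma translate_pi (h : R) (u : moderate_net) :
  translate h (\pi_colombeau u) = \pi_colombeau (moderate_net_shift h u).
Proof.
apply/colombeauP.
apply: (@negligible_shift h (fun e x => repr (\pi_colombeau u) e x - u e x)).
by apply/colombeauP; rewrite reprK.
Qed.

(** The choice of the representative is immaterial, by
    [generalized_constant_pi]. *)
Definition generalized_constant (f : colombeau) :=
  exists2 u : moderate_net, \pi_colombeau u = f &
    negligible (fun e x => u e x - u e 0).

Lemma negligible_value0 u : negligible u -> negligible (fun e _ => u e 0).
Proof.
move=> /negligibleP[us Hu]; apply/negligibleP; split=> [e|K Kc k b].
  exact: smooth_cst.
have [c c0 H] := Hu [set 0] (@compact_set1 _ _) 0%N b.
exists c => //; apply: filterS H => e H x _.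
rewrite (derive1n_cst k (u e 0)); case: k => [|k]; first exact: H.
by rewrite normr0 mulr_ge0 ?powR_ge0// ltW.
Qed.

Lemma negligibleD u v : negligible u -> negligible v -> negligible (u + v).
Proof.
move=> /negligibleP[us Hu] /negligibleP[vs Hv]; apply/negligibleP.
split=> [e|K Kc k b]; first exact: (smoothD (us e) (vs e)).
exact: pointwiseOD us vs (Hu K Kc k b) (Hv K Kc k b).
Qed.

Lemma negligibleB u v : negligible u -> negligible v -> negligible (u - v).
Proof.
move=> /negligibleP[us Hu] /negligibleP[vs Hv]; apply/negligibleP.
split=> [e|K Kc k b]; first exact: (smoothB (us e) (vs e)).
exact: pointwiseOB us vs (Hu K Kc k b) (Hv K Kc k b).
Qed.

Lemma generalized_constant_pi (u : moderate_net) :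
  generalized_constant (\pi_colombeau u) <->
  negligible (fun e x => u e x - u e 0).
Proof.
split=> [[v /esym/colombeauP uv v0]|]; last by exists u.
have := negligibleB (negligibleD uv v0) (negligible_value0 uv).
congr negligible; apply/funext => e; apply/funext => x.
rewrite ![LHS]/GRing.add/= ![in LHS]/GRing.opp/=.
rewrite -[LHS]/((u e x - v e x) + (v e x - v e 0) - (u e 0 - v e 0)).
by rewrite addrA subrK opprB addrA subrK.
Qed.

End nets.

(* Main.v *)
Require Import Defs.
From mathcomp Require Import all_boot all_order all_algebra.
From mathcomp Require Import all_classical all_reals all_analysis.
From mathcomp Require Import generic_quotient complex ring lra.

(** Let [u] be a representative of [f].  Up to errors smaller than every power of
    [e], the function [u e] and its derivatives are unchanged by the translations
    by [1] and [alpha], hence take almost the same value at [0] and at every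
    point [k * alpha - p].  These points are dense since [alpha] is irrational,
    and by continuity [u e] should be almost constant.  What has to be controlled
    is the loss: the error grows linearly with [k], and it stays negligible only
    if [k] is bounded by a power of [1 / e].

    This is where algebraicity enters.  By moderateness [u e] is Lipschitz with a
    constant [e `^ a], so an approximation of [x] by [k * alpha - p] within a fixed
    power [1 / N = e `^ s] is enough.  Dirichlet's pigeonhole principle gives
    [q <= N] such that [beta = q * alpha - p] satisfies [`|beta| <= 1 / N], and
    Liouville's inequality ([liouville_inequality]) bounds [`|beta|] from below by a
    power of [1 / N].  The multiples of [beta] are thus [1 / N]-dense modulo [1],
    and only polynomially many of them in [N] are needed ([effective_density]).
    The points are joined to [0] inside a fixed compact window ([walk_from0]),
    because the increments are only controlled on compact sets.

    Applied to the [k]-th derivative [v] of [u e], this shows that [v x - v 0] is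
    negligible ([almost_periodic_almost_constant]).  For [k > 0] the number [v 0]
    is negligible too: it is close to the increment over [0, 1] of the derivative
    of order [k - 1], which is negligible by periodicity
    ([norm_increment_sub_derive1]). *)

Set Implicit Arguments.
Unset Strict Implicit.
Unset Printing Implicit Defensive.

Import Order.TTheory GRing.Theory Num.Theory.
Import numFieldNormedType.Exports.

Local Open Scope classical_set_scope.
Local Open Scope ring_scope.

(** * Diophantine approximation of algebraic numbers *)

Section effective_approximation.
Variables (R : realType) (alpha : R).

(** A root of a rational polynomial that is itself rational can be divided out
    without losing the irrational root [alpha].  The minimal polynomial would
    do too; induction on the size avoids irreducibility. *)
Lemma annihilator_without_rational_root :
  irrational alpha -> algebraicOver (ratr : rat -> R) alpha ->
  exists2 P : {poly int}, root (map_poly intr P) alpha &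
    forall r : rat, ~~ root (map_poly intr P) (ratr r : R).
Proof.
move=> alpha_irr [P0 P0_neq0 P0_root].
have [n] := ubnP (size P0); elim: n P0 P0_neq0 P0_root => // n IHn P0 P0n0 P0a.
rewrite ltnS => sP0.
have [[r r_root]|no_root] := pselect (exists r : rat, root P0 r).
  have [Q PQ] := factor_theorem _ _ r_root.
  have Qn0 : Q != 0 by apply: contraNneq P0n0 => Q0; rewrite PQ Q0 mul0r.
  apply: (IHn Q Qn0); last first.
    by apply: leq_trans sP0; rewrite PQ size_Mmonic ?monicXsubC// size_XsubC addn2.
  move: P0a; rewrite PQ rmorphM/= map_polyXsubC rootM root_XsubC.
  by case/orP => // /eqP ar; case: alpha_irr; exists r.
have [P [a a_neq0 P0E]] := rat_poly_scale P0.
have PE (S : fieldType) (h : {rmorphism rat -> S}) :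
    map_poly intr P = h a%:~R *: map_poly h P0.
  rewrite P0E map_polyZ scalerA -rmorphM/= divff ?intr_eq0// rmorph1 scale1r.
  by rewrite -map_poly_comp; apply: eq_map_poly => z /=; rewrite rmorph_int.
exists P => [|r]; first by rewrite (PE _ ratr) rootE hornerZ (rootP P0a) mulr0.
rewrite (PE _ ratr) rootE hornerZ horner_map mulf_eq0 !fmorph_eq0 intr_eq0 negb_or.
by rewrite a_neq0; apply/negP => P0r; apply: no_root; exists r.
Qed.

Lemma horner_frac_int (P : {poly int}) (p : int) (q : nat) : (0 < q)%N ->
  q%:R ^+ size P * (map_poly intr P).[p%:~R / q%:R] \is a @Num.int R.
Proof.
move=> q0; rewrite (@horner_coef_wide _ (size P)) ?size_poly// mulr_sumr.
apply: rpred_sum => i _; rewrite coef_map/=.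
have -> : q%:R ^+ size P = q%:R ^+ (size P - i) * q%:R ^+ i :> R.
  by rewrite -exprD subnK// ltnW.
rewrite expr_div_n mulrCA -mulrA.
rewrite [_ * (_ / _)]mulrC divfK ?expf_neq0 ?pnatr_eq0 -?lt0n//.
by rewrite !(rpredM, rpredX)//= ?natr_int// ?intr_int.
Qed.

Definition diophantine c D :=
  forall (q : nat) (p : int), (0 < q)%N -> c / q%:R ^+ D <= `|q%:R * alpha - p%:~R|.

(** If [P] is an integer polynomial of size [s] that kills [alpha] but no
    rational, then [q ^+ s * P.[p / q]] is a nonzero integer, hence at least
    [1] in modulus, while for [p / q] at distance at most [1] from [alpha] the
    modulus of [P.[p / q]] is at most a constant times [`|alpha - p / q|], because
    ['X - alpha%:P] divides [P]. *)
Lemma liouville_inequality :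
  irrational alpha -> algebraicOver (ratr : rat -> R) alpha ->
  exists D, exists2 c, 0 < c & diophantine c D.
Proof.
move=> alpha_irr /(annihilator_without_rational_root alpha_irr)[P Pa Pr].
have [Q PQ] := factor_theorem _ _ Pa.
have [B QB] := poly_disk_bound Q (`|alpha| + 1).
exists (size P), (Num.max B 1)^-1; first by rewrite invr_gt0 lt_max ltr01 orbT.
move=> q p q0; set y := p%:~R / q%:R : R.
have qR0 : 0 < q%:R :> R by rewrite ltr0n.
have -> : q%:R * alpha - p%:~R = q%:R * (alpha - y).
  by rewrite mulrBr /y mulrCA divff ?gt_eqF// mulr1.
have B1 : 1 <= Num.max B 1 by rewrite le_max lexx orbT.
have B0 : 0 < Num.max B 1 by exact: lt_le_trans B1.
have q1 : 1 <= q%:R :> R by rewrite ler1n.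
rewrite normrM (ger0_norm (ltW qR0)).
apply: (@le_trans _ _ `|alpha - y|); last by rewrite ler_peMl.
have [far|near] := ltP 1 `|alpha - y|.
  apply: le_trans (ltW far); rewrite ler_pdivrMr ?exprn_gt0// mul1r.
  by apply: (@le_trans _ _ 1); [rewrite invf_le1|rewrite exprn_ege1].
have Py0 : q%:R ^+ size P * (map_poly intr P).[y] != 0.
  rewrite mulf_neq0 ?expf_neq0 ?(gt_eqF qR0)//.
  by have := Pr (p%:~R / q%:R); rewrite fmorph_div/= ratr_int ratr_nat rootE.
have := norm_intr_ge1 (horner_frac_int P p q0) Py0.
rewrite normrM ger0_norm ?exprn_ge0// PQ hornerM hornerXsubC normrM (distrC y).
move=> H; rewrite ler_pdivrMr ?exprn_gt0// -div1r ler_pdivrMr//.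
apply: (le_trans H); rewrite -[leRHS]mulrA [leRHS]mulrCA.
rewrite ler_wpM2l ?exprn_ge0// [leRHS]mulrC ler_wpM2r//.
apply: (@le_trans _ _ B); last by rewrite le_max lexx.
apply: QB; have -> : p%:~R / q%:R = alpha - (alpha - y) by rewrite subKr.
by rewrite (le_trans (ler_normB _ _))// lerD2l.
Qed.

(** Pigeonhole: two of the [N.+1] fractional parts of [i * alpha], [i <= N],
    fall in the same box of width [1 / N]. *)
Lemma dirichlet_approximation (N : nat) : (0 < N)%N ->
  exists q : nat, exists2 p : int, (0 < q <= N)%N &
    `|q%:R * alpha - p%:~R| <= N%:R^-1.
Proof.
move=> N0; have NR0 : 0 < N%:R :> R by rewrite ltr0n.
pose fr i : R := i%:R * alpha - (Num.floor (i%:R * alpha))%:~R.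
have fr_ge0 i : 0 <= fr i by rewrite subr_ge0 Num.Theory.floor_le.
have fr_lt1 i : fr i < 1.
  by rewrite ltrBlDr addrC -[1]/(1%:~R) -intrD floorD1_gt.
have box_lt (i : 'I_N.+1) : (Num.truncn (N%:R * fr i) < N)%N.
  by rewrite truncn_lt_nat ?mulr_ge0// gtr_pMr.
pose box (i : 'I_N.+1) : 'I_N := Ordinal (box_lt i).
have [i [j [ij boxij]]] : exists i j : 'I_N.+1, (i < j)%N /\ box i = box j.
  have /injectivePn[i [j ij boxij]] : ~~ injectiveb box.
    by apply/injectiveP => /leq_card; rewrite !card_ord ltnn.
  by have [ij'|ji|/val_inj e] := ltngtP i j; [exists i, j|exists j, i|rewrite e eqxx in ij].
exists (j - i)%N, (Num.floor (j%:R * alpha) - Num.floor (i%:R * alpha)).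
  by rewrite subn_gt0 ij (leq_trans (leq_subr _ _))// -ltnS.
have -> : (j - i)%N%:R * alpha
    - (Num.floor (j%:R * alpha) - Num.floor (i%:R * alpha))%:~R = fr j - fr i.
  by rewrite (natrB _ (ltnW ij)) intrB /fr; ring.
rewrite -(ler_pM2l NR0) divff ?gt_eqF// -(ger0_norm (ltW NR0)) -normrM mulrBr.
have/andP[] := truncn_itv (mulr_ge0 (ltW NR0) (fr_ge0 i)).
have/andP[] := truncn_itv (mulr_ge0 (ltW NR0) (fr_ge0 j)).
have -> : Num.truncn (N%:R * fr j) = Num.truncn (N%:R * fr i).
  by case: boxij.
rewrite -natr1 => *; rewrite ler_norml; apply/andP; split; lra.
Qed.

(** The points [k * alpha - p] with [k] polynomially bounded in [N] are
    [1 / N]-dense: by pigeonhole some [beta = q * alpha - p] with [q <= N] is at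
    most [1 / N] in modulus, and the Diophantine lower bound on [beta] limits to
    [N ^+ D / c] the number of multiples of [beta] needed to cross a unit
    interval. *)
Lemma effective_density c D : 0 < c -> diophantine c D ->
  forall (N : nat) (x : R), (0 < N)%N -> exists k : nat, exists2 p : int,
    k%:R <= c^-1 * N%:R ^+ D.+1 & `|k%:R * alpha - p%:~R - x| <= N%:R^-1.
Proof.
move=> c0 alpha_dio N x N0.
have [q [p /andP[q0 qN] beta_le]] := dirichlet_approximation N0.
set beta := q%:R * alpha - p%:~R in beta_le.
have qR0 : 0 < q%:R :> R by rewrite ltr0n.
have beta_ge : c / N%:R ^+ D <= `|beta|.
  apply: le_trans (alpha_dio q p q0); rewrite ler_pM2l//.
  by rewrite lef_pV2 ?posrE ?exprn_gt0 ?ltr0n// lerXn2r ?nnegrE// ler_nat.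
have beta0 : 0 < `|beta|.
  by apply: lt_le_trans beta_ge; rewrite divr_gt0 ?exprn_gt0 ?ltr0n.
have betan0 : beta != 0 by rewrite -normr_gt0.
have [r /andP[t_ge0 t_le]] : exists r : int, 0 <= (x - r%:~R) / beta <= `|beta|^-1.
  have [b0|b0|/eqP b0] := ltgtP 0 beta; last by rewrite eq_sym b0 in betan0.
    exists (Num.floor x); have := Num.Theory.floor_le x; have := floorD1_gt x.
    rewrite intrD gtr0_norm// => *.
    have ib : 0 < beta^-1 by rewrite invr_gt0.
    apply/andP; split; first by apply: mulr_ge0; lra.
    by rewrite ler_piMl ?ltW//; lra.
  (* For negative [beta] the multiples go down, so the target [x - r] has to be
     nonpositive, whence the ceiling. *)
  exists (Num.ceil x); have := Num.Theory.ceil_ge x; have := ceilB1_lt x.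
  rewrite intrB ltr0_norm// => *.
  have ib : 0 < (- beta)^-1 by rewrite invr_gt0; lra.
  have -> : (x - (Num.ceil x)%:~R) / beta = ((Num.ceil x)%:~R - x) * (- beta)^-1.
    by rewrite invrN; ring.
  apply/andP; split; first by apply: mulr_ge0; lra.
  by rewrite ler_piMl ?ltW//; lra.
have /andP[l_le l_gt] := truncn_itv t_ge0.
set t := (x - r%:~R) / beta in t_ge0 t_le l_le l_gt.
set l := Num.truncn t in l_le l_gt.
exists (l * q)%N, (l%:Z * p - r).
  have NR1 : 1 <= N%:R :> R by rewrite ler1n.
  rewrite natrM exprS mulrCA mulrC ler_pM//; first by rewrite ler_nat.
  rewrite (le_trans l_le)// (le_trans t_le)//.
  rewrite -[leRHS]invrK invfM invrK lef_pV2 ?posrE//.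
  by rewrite divr_gt0 ?exprn_gt0 ?ltr0n.
have -> : (l * q)%N%:R * alpha - (l%:Z * p - r)%:~R - x = (l%:R - t) * beta.
  by rewrite [RHS]mulrBl divfK// natrM intrB intrM /beta; ring.
rewrite normrM; apply: le_trans beta_le; rewrite ler_piMl//.
by move: l_gt; rewrite -natr1 ler_norml => *; apply/andP; split; lra.
Qed.

End effective_approximation.

(** * Mean value inequalities for complex functions of a real variable *)

Section mean_value.
Variable R : realType.
Local Notation C := (Rcomplex R).

Lemma ler_norm_Re (z : C) : `|complex.Re z| <= `|z|.
Proof.
case: z => a b; rewrite [leRHS]/Num.norm/= -sqrtr_sqr ler_sqrt ?addr_ge0 ?sqr_ge0//.
by rewrite lerDl sqr_ge0.
Qed.

Lemma ler_norm_Im (z : C) : `|complex.Im z| <= `|z|.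
Proof.
case: z => a b; rewrite [leRHS]/Num.norm/= -sqrtr_sqr ler_sqrt ?addr_ge0 ?sqr_ge0//.
by rewrite lerDr sqr_ge0.
Qed.

Lemma ler_norm_ReDIm (z : C) : `|z| <= `|complex.Re z| + `|complex.Im z|.
Proof.
case: z => a b; rewrite [leLHS]/Num.norm/=.
rewrite -(@ler_pXn2r _ 2)// ?nnegrE ?sqrtr_ge0 ?addr_ge0//.
rewrite sqr_sqrtr ?addr_ge0 ?sqr_ge0// sqrrD !real_normK ?num_real//.
by rewrite lerD2r lerDl mulrn_wge0// mulr_ge0.
Qed.

Lemma is_derive_linear_form (l : {linear C -> R}) (f : R -> C) (x : R) :
  (forall z, `|l z| <= `|z|) -> derivable f x 1 ->
  is_derive x 1 (l \o f : R -> R) (l (derive1 f x)).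
Proof.
move=> l_le fx.
have H : h^-1 *: (((l \o f) \o shift x) (h *: 1) - (l \o f) x)
    @[h --> 0^'] --> l (derive1 f x).
  have fl : h^-1 *: ((f \o shift x) (h *: 1) - f x) @[h --> 0^'] --> derive1 f x.
    by rewrite derive1E; exact: fx.
  apply/cvgrPdist_lt => e e0.
  have /cvgrPdist_lt/(_ e e0) := fl.
  apply: filterS => h; apply: le_lt_trans.
  by rewrite /= -linearB -linearZ -linearB.
split; first by apply/cvg_ex; eexists; exact: H.
exact/cvg_lim.
Qed.

Lemma linear_form_mean_value (l : {linear C -> R}) (f : R -> C) (a b M : R) :
  (forall z, `|l z| <= `|z|) -> (forall x : R, derivable f x 1) ->
  a <= b -> (forall x, a <= x <= b -> `|derive1 f x| <= M) ->
  `|l (f b - f a)| <= M * (b - a).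
Proof.
move=> l_le fd ab fM.
have lfd (x : R) : is_derive x 1 (l \o f : R -> R) (l (derive1 f x)).
  exact: is_derive_linear_form.
have [|c cab] := MVT_segment ab (fun x _ => lfd x).
  apply: continuous_subspaceT => y.
  by apply/differentiable_continuous/derivable1_diffP; case: (lfd y).
rewrite /= linearB => ->; rewrite normrM [X in _ * X]ger0_norm ?subr_ge0//.
by rewrite ler_wpM2r ?subr_ge0// (le_trans (l_le _))// fM// -in_itv.
Qed.

(** The mean value theorem fails for complex values, so it is applied to the real
    and the imaginary part separately; the factor [2] is the price. *)
Lemma mean_value_inequality (f : R -> C) (a b M : R) :
  (forall x : R, derivable f x 1) ->
  (forall x, Num.min a b <= x <= Num.max a b -> `|derive1 f x| <= M) ->
  `|f b - f a| <= 2 * M * `|b - a|.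
Proof.
move=> fd; wlog ab : a b / a <= b => [wl|].
  have [ab|ba] := leP a b; first by have:= wl a b ab; rewrite min_l// max_r.
  rewrite -(distrC (f a)) -(distrC a) => fM.
  by apply: wl; rewrite 1?ltW// min_l ?max_r// ltW.
rewrite min_l// max_r// => fM.
rewrite (le_trans (ler_norm_ReDIm _))// [`|b - a|]ger0_norm ?subr_ge0//.
rewrite -mulrA mulr_natl mulr2n lerD//.
  by apply: (@linear_form_mean_value (@complex.Re R) f a b M ler_norm_Re).
by apply: (@linear_form_mean_value (@complex.Im R) f a b M ler_norm_Im).
Qed.

(** The mean value inequality for [f] minus the line of slope [f^`() 0].  It
    recovers the derivative at one point from an increment of [f] and from the
    oscillation of the derivative. *)
Lemma norm_increment_sub_derive1 (f : R -> C) (M : R) :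
  (forall x : R, derivable f x 1) ->
  (forall x, `[0, 1]%classic x -> `|derive1 f x - derive1 f 0| <= M) ->
  `|f 1 - f 0 - derive1 f 0| <= 2 * M.
Proof.
move=> fd fM; set a := derive1 f 0; pose line (x : R) : C := x *: a.
have line_a (x : R) : is_derive x 1 line a.
  have h : is_diff x line line by exact: is_diff_scalel.
  split; first by apply/derivable1_diffP; exact: ex_diff.
  by rewrite deriveE ?diff_val /line ?scale1r//; exact: ex_diff.
have g_a (x : R) : is_derive x 1 (f - line) (derive1 f x - a).
  by apply: is_deriveB; rewrite derive1E; exact/derivableP.
have gd (x : R) : derivable (f - line) x 1 by have [] := g_a x.
have := @mean_value_inequality (f - line) 0 1 M gd _.
rewrite subr0 normr1 mulr1 -[(f - line) 1]/(f 1 - 1 *: a).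
rewrite -[(f - line) 0]/(f 0 - 0 *: a) scale1r scale0r subr0 addrAC; apply.
rewrite min_l ?max_r ?ler01// => x x01.
by rewrite derive1E; have [_ ->] := g_a x; apply: fM; rewrite /= in_itv.
Qed.

End mean_value.

(** * Functions with two almost periods *)

Section walk.
Variables (R : realType) (V : normedModType R) (v : R -> V) (alpha A eta : R).
Hypothesis step1 : forall x, `|x| <= A -> `|v (x + 1) - v x| <= eta.
Hypothesis step_alpha : forall x, `|x| <= A -> `|v (x + alpha) - v x| <= eta.

Lemma unit_steps (j : nat) x : `|x| <= A -> `|x + j%:R| <= A ->
  `|v (x + j%:R) - v x| <= j%:R * eta.
Proof.
move=> xA; elim: j => [|j IHj]; first by rewrite addr0 subrr normr0 mul0r.
rewrite -natr1 mulrDl mul1r addrA => xjA.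
have xjA' : `|x + j%:R| <= A.
  have j0 : 0 <= j%:R :> R by [].
  by move: xA xjA; rewrite !ler_norml => /andP[? ?] /andP[? ?]; apply/andP; split; lra.
rewrite [leRHS]addrC (le_trans (ler_distD (v (x + j%:R)) _ _))//.
by rewrite lerD ?step1 ?IHj.
Qed.

(** A point [k * alpha - p] of the window [-A, A] is joined to [0] inside the
    window by [k] steps of length [alpha] and at most [k * m + A] unit steps:
    from a negative point, going up by [m] before stepping back by [alpha] keeps
    the walk inside. *)
Lemma walk_from0 (m k : nat) (p : int) :
  0 <= alpha -> alpha <= m%:R -> m%:R <= A -> `|k%:R * alpha - p%:~R| <= A ->
  `|v (k%:R * alpha - p%:~R) - v 0| <= (k%:R * (m%:R + 1) + A) * eta.
Proof.
move=> alpha_ge0 alpha_le m_le; have A0 : 0 <= A by exact: le_trans m_le.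
have eta_ge0 : 0 <= eta.
  by apply: le_trans (normr_ge0 _) (@step1 0 _); rewrite normr0.
elim: k p => [|k IHk] p.
  rewrite !mul0r !add0r => pA.
  suff [j jA Hj] : exists2 j : nat, j%:R <= A & `|v (- p%:~R) - v 0| <= j%:R * eta.
    by apply: le_trans Hj _; rewrite ler_wpM2r.
  case: p pA => j; rewrite ?NegzE ?intrN ?opprK -pmulrn ?normrN ger0_norm// => jA.
    exists j => //; rewrite distrC -{1}(addNr j%:R).
    by apply: unit_steps; rewrite ?addNr ?normrN ?normr0// ger0_norm.
  exists j.+1 => //; rewrite -{1}(add0r j.+1%:R).
  by apply: unit_steps; rewrite ?add0r ?normr0// ger0_norm.
rewrite -natr1; move sE : ((k%:R + 1) * alpha - p%:~R) => s sA.
have [s0|s0] := leP 0 s.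
  have tE : s - alpha = k%:R * alpha - p%:~R by rewrite -sE; ring.
  have tA : `|s - alpha| <= A.
    by move: sA; rewrite !ler_norml => /andP[? ?]; apply/andP; split; lra.
  have := step_alpha tA; rewrite subrK => st.
  have := IHk p; rewrite -tE => /(_ tA) t0.
  apply: le_trans (ler_distD (v (s - alpha)) _ _) _.
  apply: le_trans (lerD st t0) _.
  rewrite -[leLHS]subr0 -subr_ge0.
  have -> : ((k%:R + 1) * (m%:R + 1) + A) * eta -
    (eta + (k%:R * (m%:R + 1) + A) * eta - 0) = m%:R * eta by ring.
  by rewrite mulr_ge0.
have tE : s + m%:R - alpha = k%:R * alpha - (p - m%:Z)%:~R.
  by rewrite intrB -sE; ring.
have sm : `|s + m%:R| <= A.
  by move: sA; rewrite !ler_norml => /andP[? ?]; apply/andP; split; lra.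
have tA : `|s + m%:R - alpha| <= A.
  by move: sA; rewrite !ler_norml => /andP[? ?]; apply/andP; split; lra.
have := step_alpha tA; rewrite subrK => st.
have ss := unit_steps sA sm.
have := IHk (p - m%:Z); rewrite -tE => /(_ tA) t0.
apply: le_trans (ler_distD (v (s + m%:R)) _ _) _; rewrite distrC.
have s't := le_trans (ler_distD (v (s + m%:R - alpha)) _ _) (lerD st t0).
apply: le_trans (lerD ss s't) _.
by rewrite le_eqVlt; apply/orP; left; apply/eqP; ring.
Qed.

End walk.

Section almost_periods.
Variables (R : realType) (alpha c : R) (D m : nat).
Hypotheses (alpha_ge0 : 0 <= alpha) (alpha_le : alpha <= m%:R).
Hypotheses (c_gt0 : 0 < c) (alpha_dio : diophantine alpha c D).

(** Move from [x] to a nearby point [k * alpha - p] at the cost of the Lipschitz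
    constant, then walk to [0] at the cost of the increments.  The free
    parameter [N] balances the two contributions.  The nearby point may lie
    outside [-A, A], but by at most [1 / N <= 1]: hence the bounds on the larger
    window. *)
Lemma dist_value0_le (v : R -> Rcomplex R) (A M eta : R) (N : nat) :
  (0 < N)%N -> m%:R <= A -> (forall x : R, derivable v x 1) ->
  (forall x, `|x| <= A + 1 -> `|derive1 v x| <= M) ->
  (forall x, `|x| <= A + 1 -> `|v (x + 1) - v x| <= eta) ->
  (forall x, `|x| <= A + 1 -> `|v (x + alpha) - v x| <= eta) ->
  forall x, `|x| <= A -> `|v x - v 0| <=
    2 * M / N%:R + (c^-1 * N%:R ^+ D.+1 * (m%:R + 1) + (A + 1)) * eta.
Proof.
move=> N0 mA vd vM v1 va x xA.
have NR0 : 0 < N%:R :> R by rewrite ltr0n.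
have A0 : 0 <= A by exact: le_trans mA.
have M0 : 0 <= M by apply: le_trans (normr_ge0 _) (vM 0 _); rewrite normr0 addr_ge0.
have eta0 : 0 <= eta by apply: le_trans (normr_ge0 _) (v1 0 _); rewrite normr0 addr_ge0.
have [k [p kN]] := effective_density c_gt0 alpha_dio x N0.
set y := k%:R * alpha - p%:~R => yx.
have N1 : N%:R^-1 <= 1 :> R by rewrite invf_le1// ler1n.
have yA : `|y| <= A + 1.
  rewrite -[y](subrK x) addrC (le_trans (ler_normD _ _))// lerD//.
  exact: le_trans yx N1.
have mA1 : m%:R <= A + 1 by lra.
have y0 := walk_from0 v1 va alpha_ge0 alpha_le mA1 yA.
apply: le_trans (ler_distD (v y) _ _) _; rewrite lerD//.
  have := @mean_value_inequality R v y x M vd _.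
  rewrite distrC in yx; move=> /(_ _)/le_trans; apply.
    move=> z yzx; apply: vM; move: yA xA yzx; rewrite !ler_norml.
    by rewrite ge_min le_max => /andP[? ?] /andP[? ?] /andP[/orP[?|?] /orP[?|?]];
      apply/andP; split; lra.
  by rewrite ler_wpM2l// mulr_ge0.
apply: le_trans y0 _; rewrite ler_wpM2r// lerD2r ler_wpM2r// addr_ge0//.
Qed.

End almost_periods.

(** * Generalized functions with two periods *)

Section nets.
Variable R : realType.
Local Notation net := (eps_index R -> R -> Rcomplex R).

Definition increment (h : R) (u : net) : net := fun e x => u e (x + h) - u e x.

Lemma derive1n_increment k h (u : net) e x : smooth_net u ->
  derive1n k (increment h u e) x = derive1n k (u e) (x + h) - derive1n k (u e) x.
Proof.
move=> us; have := derive1nB k (@smooth_shift R h _ (us e)) (us e).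
by rewrite derive1n_shift => /(congr1 (fun f => f x)).
Qed.

Lemma nat_between_powers (t : R) (s : R) : 0 < t <= 1 -> 0 <= s ->
  exists2 N : nat, (0 < N)%N & t `^ (- s) <= N%:R <= 2 * t `^ (- s).
Proof.
move=> /andP[t0 t1] s0; exists (Num.truncn (t `^ (- s))).+1 => //.
have p1 : 1 <= t `^ (- s).
  by rewrite -[leLHS](powRr0 t); apply: ger_powR; rewrite ?t0// oppr_le0.
have /andP[le_p] := truncn_itv (le_trans ler01 p1).
by rewrite -natr1 => p_lt; apply/andP; split; lra.
Qed.

(** With the derivative of size [e `^ a], taking [N] of order [e `^ (- s)] with
    [a + s >= b] makes the Lipschitz contribution [O(e `^ b)].  The walk then
    has [O(e `^ (- s * D.+1))] steps, still a power of [e], so that it suffices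
    to use the negligible increments at the exponent [b + s * D.+1]. *)
Lemma almost_periodic_almost_constant (u : net) (alpha c : R) (D k : nat) :
  0 <= alpha -> 0 < c -> diophantine alpha c D -> smooth_net u ->
  (forall K, compact K -> exists b, pointwiseO u K k.+1 b) ->
  (forall K, compact K -> forall b, pointwiseO (increment 1 u) K k b) ->
  (forall K, compact K -> forall b, pointwiseO (increment alpha u) K k b) ->
  forall K, compact K -> forall b, exists2 C, 0 < C &
    \forall e \near @eps_to0 R, forall x, K x ->
      `|derive1n k (u e) x - derive1n k (u e) 0| <= C * val e `^ b.
Proof.
move=> alpha0 c0 alpha_dio us u_mod u1 ua K cK b.
have [m alpha_m] : exists m : nat, alpha <= m%:R.
  by exists (Num.bound alpha); rewrite ltW// archi_boundP.
have [A mA KA] : exists2 A, m%:R <= A & forall x, K x -> `|x| <= A.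
  have [B [_ KB]] := compact_bounded cK.
  exists (Num.max m%:R (B + 1)); first by rewrite le_max lexx.
  by move=> x Kx; rewrite le_max (KB (B + 1)) ?orbT// ltrDl.
have A0 : 0 <= A by apply: le_trans mA.
pose L := `[- (A + 1), A + 1]%classic.
have cL : compact L by exact: segment_compact.
have LE x : `|x| <= A + 1 -> L x by rewrite ler_norml /L/= in_itv.
have [a [CM CM0 HM]] := u_mod L cL.
pose s := Num.max 0 (b - a).
have s0 : 0 <= s by rewrite le_max lexx.
have bas : b <= a + s by rewrite -lerBlDl le_max lexx orbT.
have [C1 C10 H1] := u1 L cL (b + s * D.+1%:R).
have [C2 C20 H2] := ua L cL (b + s * D.+1%:R).
pose Ceta := Num.max C1 C2.
have Ceta0 : 0 < Ceta by rewrite lt_max C10.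
pose P : R := c^-1 * 2 ^+ D.+1 * (m%:R + 1) + (A + 1).
have P0 : 0 < P.
  rewrite ltr_wpDl// ?ltr_wpDl//.
  by rewrite !mulr_ge0// ?invr_ge0 ?exprn_ge0 ?addr_ge0// ltW.
exists (2 * CM + P * Ceta); first by rewrite addr_gt0 ?mulr_gt0.
near=> e => x Kx.
have vM y : L y -> `|derive1 (derive1n k (u e)) y| <= CM * val e `^ a.
  by move: y; near: e.
have v1 y : L y ->
    `|derive1n k (increment 1 u e) y| <= C1 * val e `^ (b + s * D.+1%:R).
  by move: y; near: e.
have va y : L y ->
    `|derive1n k (increment alpha u e) y| <= C2 * val e `^ (b + s * D.+1%:R).
  by move: y; near: e.
have /andP[e0 e1] := valP e; set t := val e in e0 e1 vM v1 va *.
have t01 : 0 < t <= 1 by rewrite e0 ltW.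
have [N N0 /andP[N_ge N_le]] := nat_between_powers t01 s0.
have v1' y : `|y| <= A + 1 ->
    `|derive1n k (u e) (y + 1) - derive1n k (u e) y| <= Ceta * t `^ (b + s * D.+1%:R).
  move=> /LE/v1; rewrite derive1n_increment// => /le_trans; apply.
  by rewrite ler_wpM2r ?powR_ge0// le_max lexx.
have va' y : `|y| <= A + 1 ->
    `|derive1n k (u e) (y + alpha) - derive1n k (u e) y| <= Ceta * t `^ (b + s * D.+1%:R).
  move=> /LE/va; rewrite derive1n_increment// => /le_trans; apply.
  by rewrite ler_wpM2r ?powR_ge0// le_max lexx orbT.
have := dist_value0_le alpha0 alpha_m c0 alpha_dio N0 mA (us e k)
  (fun y yA => vM y (LE y yA)) v1' va' (KA x Kx).
move=> /le_trans; apply; rewrite [leRHS]mulrDl; apply: lerD.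
  rewrite -!mulrA !ler_wpM2l// ?(ltW CM0)//.
  apply: (@le_trans _ _ (t `^ a * t `^ s)).
    rewrite ler_wpM2l ?powR_ge0// -[leRHS]invrK -powRN lef_pV2 ?posrE ?ltr0n//.
    exact: powR_gt0.
  rewrite -powRD ?(gt_eqF e0) ?implybT//.
  exact: ger_powR.
have NR1 : 1 <= t `^ (- s) ^+ D.+1.
  rewrite exprn_ege1// -[leLHS](powRr0 t).
  by apply: ger_powR; rewrite ?oppr_le0.
apply: (@le_trans _ _ (P * t `^ (- s) ^+ D.+1 * (Ceta * t `^ (b + s * D.+1%:R)))).
  rewrite ler_wpM2r ?mulr_ge0 ?powR_ge0 ?(ltW Ceta0)// /P mulrDl lerD//.
    rewrite [leRHS]mulrAC ler_wpM2r ?addr_ge0// -[leRHS]mulrA ler_wpM2l ?invr_ge0 ?(ltW c0)//.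
    by rewrite -exprMn lerXn2r ?nnegrE ?mulr_ge0 ?powR_ge0.
  by rewrite ler_peMr// addr_ge0.
rewrite -!mulrA ler_wpM2l ?(ltW P0)// mulrCA ler_wpM2l ?(ltW Ceta0)//.
rewrite -powR_mulrn ?powR_ge0// -powRrM -powRD ?(gt_eqF e0) ?implybT//.
by rewrite mulNr addrC addrK.
Unshelve. all: by end_near. Qed.

(** The oscillation estimate holds for every derivative of a representative.
    Beyond order [0] the value at [0] must be negligible as well: it is the
    increment over the period [1] of the previous derivative, up to the
    oscillation. *)
Lemma diophantine_period_constant (alpha c : R) (D : nat) (f : colombeau R) :
  0 <= alpha -> 0 < c -> diophantine alpha c D ->
  translate 1 f = f -> translate alpha f = f -> generalized_constant f.
Proof.
move=> alpha0 c0 alpha_dio; rewrite -[f]reprK; set u := repr f.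
rewrite !translate_pi => /colombeauP u1 /colombeauP ua.
have {u1} /Defs.negligibleP[_ u1] : Defs.negligible (increment 1 u) by exact: u1.
have {ua} /Defs.negligibleP[_ ua] : Defs.negligible (increment alpha u) by exact: ua.
have /moderateP[us u_mod] := moderate_netP u.
have u_const k := almost_periodic_almost_constant alpha0 c0 alpha_dio us
  (fun K cK => u_mod K cK k.+1) (fun K cK => u1 K cK k) (fun K cK => ua K cK k).
have derive0_small k b : exists2 C, 0 < C &
    \forall e \near @eps_to0 R, `|derive1n k.+1 (u e) 0| <= C * val e `^ b.
  have [C1 C10 H1] := u_const k.+1 `[0, 1]%classic (@segment_compact _ _ _) b.
  have [C2 C20 H2] := u1 [set 0] (@compact_set1 _ _) k b.
  exists (2 * C1 + C2); first by rewrite addr_gt0// mulr_gt0.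
  near=> e.
  have osc x : `[0, 1]%classic x ->
      `|derive1n k.+1 (u e) x - derive1n k.+1 (u e) 0| <= C1 * val e `^ b.
    by move: x; near: e.
  have incr : `|derive1n k (u e) 1 - derive1n k (u e) 0| <= C2 * val e `^ b.
    suff : forall x, [set 0] x -> `|derive1n k (increment 1 u e) x| <= C2 * val e `^ b.
      by move=> /(_ 0 erefl); rewrite derive1n_increment// add0r.
    by near: e.
  have := norm_increment_sub_derive1 (us e k) osc.
  set d := derive1n k (u e) 1 - _ in incr *; rewrite -derive1nS => tay.
  rewrite -[X in `|X|](subKr d) (le_trans (ler_normB _ _))// addrC mulrDl lerD//.
  by rewrite -mulrA.
apply/generalized_constant_pi/Defs.negligibleP; split=> [e|K cK k b].
  exact: (@smoothB _ _ _ (us e) (@smooth_cst R (u e 0))).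
have [C1 C10 H1] := u_const k K cK b.
(* In order [0] the subtraction of [u e 0] is part of the claim; in higher order
   it disappears and the value at [0] has to be added back. *)
case: k H1 => [|k] H1.
  by exists C1.
have [C2 C20 H2] := derive0_small k b.
exists (C1 + C2); first exact: addr_gt0.
apply: filterS2 H1 H2 => e H1 H2 x Kx.
have := derive1nB k.+1 (us e) (@smooth_cst R (u e 0)).
rewrite derive1n_cst => /(congr1 (fun f => f x)).
rewrite -[LHS]/(derive1n k.+1 (fun x => u e x - u e 0) x) => ->.
rewrite -[X in `|X|]/(derive1n k.+1 (u e) x - 0) subr0.
rewrite -[X in `|X|](subrK (derive1n k.+1 (u e) 0)) (le_trans (ler_normD _ _))//.
by rewrite mulrDl lerD// H1.
Unshelve. all: by end_near. Qed.

End nets.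

Theorem theorem11 (R : realType) (f : colombeau R) (alpha : R)
  (alpha_irrational : irrational alpha)
  (alpha_gt0 : 0 < alpha)
  (alpha_algebraic : algebraicOver (ratr : rat -> R) alpha)
  (f_periodic_1 : translate 1 f = f)
  (f_periodic_alpha : translate alpha f = f) :
  generalized_constant f.
Proof.
have [D [c c_gt0 alpha_dio]] := liouville_inequality alpha_irrational alpha_algebraic.
exact: diophantine_period_constant (ltW alpha_gt0) c_gt0 alpha_dio _ _.
Qed.
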